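(* Let $\alpha$ and $\beta$ be two positive functions of same integral over $\mathbb{R}^d$. Consider the family of all smooth convex functions $\Psi$ on $\mathbb{R}^d$ with a smooth Legendre-Fenchel transform $$\Psi^*(y)=\sup_{x\in\mathbb{R}^d}\big(x\cdot y-\Psi(x)\big).$$ Then, in this family, a solution $\Phi$ to the Monge-Ampère equation $$\beta(\nabla\Phi(x))\,\det(D^2\Phi(x))=\alpha(x),\qquad x\in\mathbb{R}^d,$$ is a minimizer of the convex functional $$J[\Psi]=\int_{\mathbb{R}^d}\Psi(x)\,\alpha(x)\,dx+\int_{\mathbb{R}^d}\Psi^*(y)\,\beta(y)\,dy.$$
   Context: Here $D^2\Phi$ denotes the Hessian matrix of $\Phi$ and $x\cdot y$ the Euclidean inner product on $\mathbb{R}^d$. The solution $\Phi$ of the Monge-Ampère equation is convex, and it is assumed a priori that $x\in\mathbb{R}^d\mapsto\nabla\Phi(x)$ is a diffeomorphism whose Jacobian matrix $D^2\Phi(x)$ is everywhere symmetric positive. *)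

(* Defs.v *)
From HB Require Import structures.
From mathcomp Require Import all_boot all_order all_algebra.
From mathcomp Require Import all_classical all_reals all_analysis.

Set Implicit Arguments.
Unset Strict Implicit.
Unset Printing Implicit Defensive.

Import Order.TTheory GRing.Theory Num.Theory.
Import numFieldNormedType.Exports.

Local Open Scope classical_set_scope.
Local Open Scope ring_scope.

(* Vectors of R^d are row vectors ['rV[R]_d].  As for tuples in the library,
   ['rV[R]_d] carries the sigma-algebra generated by the coordinate maps, which
   is the Borel sigma-algebra of R^d. *)

Section measurable_rV.
Context (R : realType) (n : nat).

Let coords (i : 'I_n) (v : 'rV[R]_n) : measurableTypeR R := v ord0 i.

Let rV_set0 : g_sigma_preimage coords set0.
Proof. exact: sigma_algebra0. Qed.

Let rV_setC (A : set 'rV[R]_n) :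
  g_sigma_preimage coords A -> g_sigma_preimage coords (~` A).
Proof. exact: sigma_algebraC. Qed.

Let rV_bigcup (F : (set 'rV[R]_n)^nat) :
  (forall i, g_sigma_preimage coords (F i)) ->
  g_sigma_preimage coords (\bigcup_i (F i)).
Proof. exact: sigma_algebra_bigcup. Qed.

HB.instance Definition _ :=
  @isMeasurable.Build (measure_tuple_display (R.-ocitv.-measurable).-sigma)
    'rV[R]_n (g_sigma_preimage coords) rV_set0 rV_setC rV_bigcup.

Lemma measurable_coord (i : 'I_n) :
  measurable_fun [set: 'rV[R]_n] (fun v => v ord0 i : measurableTypeR R).
Proof.
move=> _ Y mY; rewrite setTI; apply: sub_sigma_algebra => /=.
rewrite -bigcup_seq/=; exists i => /=; first by rewrite mem_index_enum.
by exists Y => //; rewrite setTI.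
Qed.

End measurable_rV.

Section lebesgue_rV.
Context (R : realType).

Definition rV_cons n (p : measurableTypeR R * 'rV[R]_n) : 'rV[R]_n.+1 :=
  row_mx (p.1%:M : 'rV[R]_1) p.2.

Lemma measurable_rV_cons n :
  measurable_fun [set: measurableTypeR R * 'rV[R]_n] (@rV_cons n).
Proof.
suff coordP (i : 'I_n.+1) :
    measurable_fun [set: measurableTypeR R * 'rV[R]_n]
      (fun p => rV_cons p ord0 i : measurableTypeR R).
  move=> _ Y mY; rewrite setTI.
  have := mY (image_set_system setT (@rV_cons n) measurable).
  rewrite /image_set_system /= setTI; apply; split.
    exact/sigma_algebra_image/sigma_algebra_measurable.
  rewrite -bigcup_mkord_ord; apply: bigcup_sub => i _ A [B mB <-] /=.
  by have := coordP (inord i) measurableT _ mB; rewrite !setTI.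
have [j ->|->] := unliftP ord0 i.
- rewrite (_ : (fun p => _) = (fun v : 'rV[R]_n => v ord0 j) \o snd).
    exact: measurableT_comp (@measurable_coord R n j) measurable_snd.
  apply/funext => p; rewrite /rV_cons.
  have -> : lift ord0 j = rshift 1 j by exact: val_inj.
  exact: row_mxEr.
- rewrite (_ : (fun p => _) = fst); first exact: measurable_fst.
  apply/funext => p.
  have -> : (ord0 : 'I_n.+1) = lshift n (ord0 : 'I_1) by exact: val_inj.
  by rewrite [LHS]row_mxEl mxE.
Qed.

(* Lebesgue measure on R^(n+1) is the product of those on R and R^n. *)
Fixpoint lebesgue_rV n : {measure set 'rV[R]_n -> \bar R} :=
  match n with
  | 0 => \d_(0 : 'rV[R]_0)
  | n.+1 => measure_function_pushforward__canonical__measure_function_Measure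
      (lebesgue_measure \x^ lebesgue_rV n)%E (@measurable_rV_cons n)
  end.

End lebesgue_rV.

Section smooth.
Context (R : realType) (d : nat).
Implicit Types (f : 'rV[R]_d -> R) (x v : 'rV[R]_d).

Definition partial (i : 'I_d) f : 'rV[R]_d -> R :=
  fun x => 'D_(delta_mx ord0 i) f x.

(* C^infinity: [f] and all its iterated partial derivatives are differentiable
   in the sense of Frechet at every point. *)
Definition smooth f :=
  forall (s : seq 'I_d) x, differentiable (foldr partial f s : _ -> R^o) x.

Definition gradient f x : 'rV[R]_d := \row_i partial i f x.

Definition hessian f x : 'M[R]_d := \matrix_(i, j) partial i (partial j f) x.

Definition smooth_map (F : 'rV[R]_d -> 'rV[R]_d) :=
  forall i : 'I_d, smooth (fun x => F x ord0 i).

Definition diffeomorphism (F : 'rV[R]_d -> 'rV[R]_d) :=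
  smooth_map F /\
  exists G, [/\ cancel F G, cancel G F & smooth_map G].

Definition dot x v : R := \sum_i x ord0 i * v ord0 i.

Definition symmetric_positive (A : 'M[R]_d) :=
  A^T = A /\ forall v, v != 0 -> 0 < dot (v *m A) v.

End smooth.

Section monge_ampere.
Context (R : realType) (d : nat).
Local Open Scope ereal_scope.
Implicit Types (a b Psi Phi : 'rV[R]_d -> R).

Definition legendre Psi (y : 'rV[R]_d) : \bar R :=
  ereal_sup [set (dot x y - Psi x)%:E | x in [set: 'rV[R]_d]].

Definition smooth_legendre_family : set ('rV[R]_d -> R) :=
  [set Psi | [/\ smooth Psi,
    convex_function [set: convex_lmodType 'rV[R]_d] (Psi : _ -> R^o),
    forall y, legendre Psi y \is a fin_num
    & smooth (fine \o legendre Psi)]].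

(* When [a] and [b] are nonnegative and integrable, and [Psi] belongs to the
   family, [Psi] and [legendre Psi] are bounded from below (each is the
   conjugate of an everywhere finite function), so that neither integral is -oo
   and the value of [J a b Psi] is meaningful, possibly +oo. *)
Definition J a b Psi : \bar R :=
  \int[lebesgue_rV R d]_x (Psi x * a x)%:E +
  \int[lebesgue_rV R d]_y (legendre Psi y * (b y)%:E).

Definition monge_ampere_solution a b Phi :=
  [/\ diffeomorphism (gradient Phi),
    forall x, symmetric_positive (hessian Phi x)
    & forall x, (b (gradient Phi x) * \det (hessian Phi x) = a x)%R].

Definition minimizer (F : set ('rV[R]_d -> R)) (K : ('rV[R]_d -> R) -> \bar R)
    Phi :=
  F Phi /\ forall Psi, F Psi -> K Phi <= K Psi.

Definition convex_functional (F : set ('rV[R]_d -> R))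
    (K : ('rV[R]_d -> R) -> \bar R) :=
  forall (t : R) Psi0 Psi1, (0 <= t <= 1)%R -> F Psi0 -> F Psi1 ->
  K (fun x => (1 - t) * Psi0 x + t * Psi1 x)%R <=
  (1 - t)%:E * K Psi0 + t%:E * K Psi1.

End monge_ampere.

(* Main.v *)
From HB Require Import structures.
Require Import Defs.
From mathcomp Require Import all_boot all_order all_algebra.
From mathcomp Require Import all_classical all_reals all_analysis.
From mathcomp Require Import measurable_realfun.
From mathcomp Require Import ring lra.

Set Implicit Arguments.
Unset Strict Implicit.
Unset Printing Implicit Defensive.

Import Order.TTheory GRing.Theory Num.Theory.
Import numFieldNormedType.Exports.

Local Open Scope classical_set_scope.
Local Open Scope ring_scope.

(** For every [Psi] of the family, Fenchel's inequality
    [x . y <= Psi x + Psi^* y], taken at [y = grad Phi x] and integrated against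
    [alpha], reads [int x . grad Phi alpha <= J Psi], because the Monge-Ampere
    equation says that [grad Phi] carries [alpha dx] to [beta dy]. For
    [Psi = Phi] it is an equality, so [Phi] is a minimizer
    ([monge_ampere_minimizer]). Convexity of [J] follows from the fact that
    [Psi^*] is a supremum of affine functions of [Psi] ([J_convex]).

    The substance is the change of variables [y = grad Phi x] in [R^d]
    ([ge0_integral_convex_gradient]). Since [Phi] is convex and its Legendre
    transform is finite, it can be proved globally, by induction on [d], from
    the one-dimensional substitution rule and Tonelli's theorem. Write
    [x = (a, v)] with [a] real. For fixed [v], the first coordinate of
    [grad Phi (a, v)] is an increasing bijection of [R] in [a], with inverse
    [g (., v)]: it increases because the Hessian [H] is positive definite, and
    it is onto because [Phi] grows faster than any linear function. Using
    [y = grad_1 Phi (a, v)] in place of [a], for each [y] there remains the map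
    [v |-> grad_v Phi (g (y, v), v)]. It is the gradient of the partial Legendre
    transform [inf_a (Phi (a, v) - a y)], which is again convex with a finite
    Legendre transform, and its Jacobian matrix is the Schur complement of
    [H_11] in [H] ([slice_convex_gradient]). The identity
    [det H = H_11 * det (schur H)] ([det_schur]) distributes the Jacobian
    determinant over the two steps.

    All functions integrated in [J] have an integrable minorant, because [Psi]
    and [Psi^*] are bounded below when both are finite and the weights are
    integrable; for such functions the integral is additive and monotone without being finite
    ([integral_minorizedD], [le_integral_minorized]). *)

(** * Substitution on the real line *)

Section density.
Local Open Scope ereal_scope.
Context d (T : measurableType d) (R : realType).
Variables (mu : {measure set T -> \bar R}) (a : T -> R).
Hypothesis ma : measurable_fun [set: T] a.
Hypothesis a_ge0 : forall x, (0 <= a x)%R.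

Definition density_measure (A : set T) : \bar R := \int[mu]_(x in A) (a x)%:E.

Let density0 : density_measure set0 = 0.
Proof. exact: integral_set0. Qed.

Let density_ge0 A : 0 <= density_measure A.
Proof. by apply: integral_ge0 => x _; rewrite lee_fin. Qed.

Let density_sigma_additive : semi_sigma_additive density_measure.
Proof.
move=> F mF tF mUF; rewrite /density_measure ge0_integral_bigcup//.
- by apply: is_cvg_nneseries => n _ _; exact: density_ge0.
- by apply/measurable_EFinP; exact: measurable_funTS.
- by move=> x _; rewrite lee_fin.
Qed.

HB.instance Definition _ := isMeasure.Build _ _ _ density_measure
  density0 density_ge0 density_sigma_additive.

Import HBNNSimple.

Let integral_density (f : T -> \bar R) :
  measurable_fun setT f -> (forall x, 0 <= f x) ->
  \int[density_measure]_x f x = \int[mu]_x (f x * (a x)%:E).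
Proof.
move=> mf f0; pose f_ := nnsfun_approx measurableT mf.
have cvgf x : (f_ n x)%:E @[n --> \oo] --> f x by exact: cvg_nnsfun_approx.
transitivity (limn (fun n => \int[density_measure]_x (f_ n x)%:E)).
  rewrite -monotone_convergence//.
  - by apply: eq_integral => x _; apply/esym/cvg_lim => //; exact: cvgf.
  - by move=> n; exact/measurable_EFinP/measurable_funP.
  - by move=> n x _; rewrite lee_fin.
  - by move=> x _ m n mn; rewrite lee_fin; exact/lefP/nd_nnsfun_approx.
transitivity (limn (fun n => \int[mu]_x ((f_ n x)%:E * (a x)%:E))); last first.
  rewrite -monotone_convergence//.
  - apply: eq_integral => x _; apply/cvg_lim => //.
    exact: cvgeZr (cvgf x).
  - move=> n; apply/measurable_EFinP/measurable_funM => //.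
  - by move=> n x _; rewrite lee_fin mulr_ge0.
  - move=> x _ m n mn; rewrite lee_fin ler_wpM2r//.
    exact/lefP/nd_nnsfun_approx.
congr (limn _); apply/funext => n.
transitivity (\sum_(k \in range (f_ n))
    \int[density_measure]_x (k * \1_(f_ n @^-1` [set k]) x)%:E).
  under eq_integral do rewrite fimfunE -fsumEFin//.
  rewrite ge0_integral_fsum//.
  - by move=> y; exact/measurable_EFinP/measurable_funM.
  - by move=> y x _; rewrite nnfun_muleindic_ge0.
transitivity (\sum_(k \in range (f_ n))
    \int[mu]_x ((k * \1_(f_ n @^-1` [set k]) x)%:E * (a x)%:E)); last first.
  rewrite -ge0_integral_fsum//.
  - apply: eq_integral => x _.
    rewrite -ge0_mule_fsuml => [|k]; last by rewrite nnfun_muleindic_ge0.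
    by rewrite fsumEFin// -fimfunE.
  - move=> k; apply/measurable_EFinP; apply: measurable_funM => //.
    exact: measurable_funM.
  - by move=> k x _; rewrite mule_ge0 ?lee_fin// -lee_fin nnfun_muleindic_ge0.
apply: eq_fsbigr => r /[!inE] -[x _ fxr].
have r0 : (0 <= r)%R by rewrite -fxr.
under [LHS]eq_integral do rewrite EFinM.
under [RHS]eq_integral do rewrite EFinM -muleA.
rewrite !ge0_integralZl_EFin//.
- congr (_ * _); rewrite integral_indic// setIT.
  transitivity (\int[mu]_(x in f_ n @^-1` [set r]) (a x)%:E) => //.
  rewrite [LHS]integral_mkcond; apply: eq_integral => y _.
  rewrite patchE indicE; case: (y \in _) => //=; first by rewrite mul1e.
  by rewrite mul0e.
all: try by move=> y _; rewrite -?EFinM lee_fin ?mulr_ge0.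
all: apply/measurable_EFinP => //; exact: measurable_funM.
Qed.

(** The measure with density [a] is packaged existentially, because a canonical
    structure on [density_measure] could not recover the proofs that [a] is
    measurable and nonnegative. *)
Lemma density_measureP : exists nu : {measure set T -> \bar R},
  (forall A, nu A = \int[mu]_(x in A) (a x)%:E) /\
  forall f, measurable_fun setT f -> (forall x, 0 <= f x) ->
    \int[nu]_x f x = \int[mu]_x (f x * (a x)%:E).
Proof. by exists density_measure; split => //; exact: integral_density. Qed.

End density.

Section substitution_line.
Context (R : realType).
Local Notation mu := (@lebesgue_measure R).

(** Both sides integrate [h], against Lebesgue measure on the right and against
    the image under [u] of the measure with density [a] on the left. By the
    fundamental theorem of calculus these two measures agree on half-open
    intervals, whose preimages under [u] are again half-open intervals, hence
    they agree on all Borel sets. *)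
Lemma ge0_integral_substitution_line (u a g : R -> R)
    (h : measurableTypeR R -> \bar R) :
  (forall x, is_derive x (1 : R) u (a x)) -> continuous a ->
  (forall x, 0 < a x) -> cancel u g -> cancel g u ->
  measurable_fun setT h -> (forall y, 0 <= h y)%E ->
  (\int[mu]_x (h (u x) * (a x)%:E) = \int[mu]_y h y)%E.
Proof.
move=> du ca a0 ug gu mh h0.
have cu : continuous u.
  move=> x; apply: differentiable_continuous.
  by apply/derivable1_diffP; have [] := du x.
have u_incr : {mono u : x y / x <= y}.
  apply: le_mono => x y xy; rewrite -subr_gt0.
  have [|z _ ->] := @MVT R u a x y xy (fun x _ => du x).
    exact: continuous_subspaceT.
  by rewrite mulr_gt0// subr_gt0.
have g_incr : {mono g : x y / x <= y}.
  by move=> x y; rewrite -u_incr !gu.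
have mu_ : measurable_fun [set: measurableTypeR R] (u : _ -> measurableTypeR R).
  exact: continuous_measurable_fun.
have ma : measurable_fun [set: measurableTypeR R] (a : measurableTypeR R -> R).
  exact: continuous_measurable_fun.
have age0 (x : measurableTypeR R) : 0 <= a x by exact: ltW.
have [mua [muaE int_mua]] := density_measureP mu ma age0.
pose nu := measure_function_pushforward__canonical__measure_function_Measure
  mua mu_.
have muE (A : set (measurableTypeR R)) : measurable A -> mu A = nu A.
  apply: lebesgue_measure_unique => _ [[p q]] _ <-.
  rewrite /nu /= /pushforward muaE.
  have -> : u @^-1` `]p, q] = `]g p, g q]%classic.
    apply/seteqP; split => x /=; rewrite !in_itv/=.
      by rewrite -{1}[p]gu -{1}[q]gu (leW_mono u_incr) u_incr.
    by rewrite -{2}[p]gu -{2}[q]gu (leW_mono u_incr) u_incr.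
  rewrite lebesgue_measure_itv/= lte_fin.
  have [pq|qp] := ltP p q; last first.
    by rewrite set_itv_ge ?integral_set0// bnd_simp -leNgt g_incr.
  rewrite integral_itv_obnd_cbnd; last first.
    exact/measurable_EFinP/measurable_funTS.
  rewrite (@continuous_FTC2 R a u) ?gu//.
  - by rewrite (leW_mono g_incr).
  - exact: continuous_subspaceT.
  - split => [x _||]; first by have [] := du x.
    + by apply: cvg_at_right_filter; exact: cu.
    + by apply: cvg_at_left_filter; exact: cu.
  - by move=> x _; rewrite derive1E; exact: derive_val.
transitivity (\int[nu]_y h y)%E; last first.
  by apply: eq_measure_integral => A mA _; rewrite -muE.
rewrite ge0_integral_pushforward// preimage_setT int_mua//=.
exact: measurableT_comp.
Qed.

End substitution_line.

(** * Measurability and iterated integrals on row vectors *)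

Section measurable_row_vectors.
Context (R : realType).

Lemma measurable_fun_rV d (T : measurableType d) n (f : T -> 'rV[R]_n) :
  (forall i, measurable_fun [set: T] (fun x => f x ord0 i : measurableTypeR R)) ->
  measurable_fun [set: T] f.
Proof.
move=> coordP _ Y mY; rewrite setTI.
have := mY (image_set_system setT f measurable).
rewrite /image_set_system /= setTI; apply; split.
  exact/sigma_algebra_image/sigma_algebra_measurable.
move: n f coordP {Y mY} => [|n] f coordP.
  by rewrite big_ord0.
rewrite -bigcup_mkord_ord; apply: bigcup_sub => i _ A [B mB <-] /=.
by have := coordP (inord i) measurableT _ mB; rewrite !setTI.
Qed.

(** The sigma-algebra is generated by coordinates, and the topology by sup-norm
    balls, which are boxes: an open set is the countable union of the boxes with
    rational centre and radius [1/(k+1)] that it contains. *)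
Lemma open_measurable_rV n (U : set 'rV[R]_n) : open U -> measurable U.
Proof.
move=> oU.
pose q2r (q : 'rV[rat]_n) : 'rV[R]_n := \row_j ratr (q ord0 j).
pose box (p : 'rV[rat]_n * nat) := ball (q2r p.1) (p.2.+1%:R^-1 : R).
have -> : U = \bigcup_(p in [set p | box p `<=` U]) box p.
  apply/seteqP; split => [x Ux|x [p /= pU]]; last exact: pU.
  have /nbhs_ballP[e /= e0 eU] : nbhs x U by exact: open_nbhs_nbhs.
  have [k ke] : exists k : nat, k.+1%:R^-1 < e / 2.
    have [k _ /(_ k (leqnn k)) ke] :=
      near_infty_natSinv_lt (PosNum (divr_gt0 e0 (ltr0Sn R 1))).
    by exists k.
  have k0 : 0 < k.+1%:R^-1 :> R by rewrite invr_gt0.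
  have kk2 : k.+1%:R^-1 + k.+1%:R^-1 <= e by move: (k.+1%:R^-1) ke => r; lra.
  have /choice[q qx] : forall j : 'I_n, exists r : rat, `|x ord0 j - ratr r| < k.+1%:R^-1.
    move=> j.
    have [|r] := @rat_in_itvoo R (x ord0 j - k.+1%:R^-1) (x ord0 j + k.+1%:R^-1).
      by move: (k.+1%:R^-1) k0 => r; lra.
    rewrite in_itv/= => /andP[xr rx]; exists r.
    by rewrite distrC ltr_distl; apply/andP; split.
  have xq : ball (q2r (\row_j q j)) (k.+1%:R^-1 : R) x.
    split=> // i j; rewrite (ord1 i) /ball/= !mxE distrC; exact: qx.
  exists (\row_j q j, k) => //= y yq; apply: eU.
  apply: (@le_ball _ _ x (k.+1%:R^-1 + k.+1%:R^-1)); first by [].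
  exact: ball_triangle (ball_sym xq) yq.
have mbox p : measurable (box p).
  have -> : box p = \big[setI/setT]_(j < n)
      ((fun v : 'rV[R]_n => v ord0 j : measurableTypeR R) @^-1`
       (ball (q2r p.1 ord0 j) (p.2.+1%:R^-1 : R))).
    apply/seteqP; split => x.
      by move=> [_ px]; rewrite -bigcap_seq => j _; exact: px.
    rewrite -bigcap_seq => px; split=> [|i j]; first by rewrite invr_gt0.
    by rewrite (ord1 i); apply: px; rewrite /= mem_index_enum.
  apply: bigsetI_measurable => j _.
  rewrite -[X in measurable X]setTI; apply: measurable_coord => //.
  apply: (@open_measurable R); exact: ball_open.
rewrite bigcup_mkcond; apply: countable_bigcupT_measurable => // p.
by case: ifP.
Qed.

Lemma continuous_measurable_rV n (f : 'rV[R]_n -> R) :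
  continuous f -> measurable_fun [set: 'rV[R]_n] f.
Proof.
move=> /continuousP cf; apply: (measurability _ (RGenOpens.measurableE R)).
move=> _ [_ [a [b ->] <-]]; rewrite setTI; apply: open_measurable_rV.
by apply: cf; exact: interval_open.
Qed.

End measurable_row_vectors.

Section iterated_integrals.
Local Open Scope ereal_scope.
Context (R : realType).

Definition rV_split n (v : 'rV[R]_n.+1) : measurableTypeR R * 'rV[R]_n :=
  (v ord0 ord0, rsubmx (v : 'rV[R]_(1 + n))).

Lemma rV_consK n : cancel (@rV_cons R n) (@rV_split n).
Proof.
move=> [a v]; rewrite /rV_cons /rV_split/= row_mxKr; congr (_, _).
have -> : (ord0 : 'I_n.+1) = lshift n (ord0 : 'I_1) by exact: val_inj.
by rewrite [LHS]row_mxEl mxE.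
Qed.

Lemma rV_splitK n : cancel (@rV_split n) (@rV_cons R n).
Proof.
move=> v; apply: etrans (@hsubmxK _ 1 1 n v); congr row_mx.
apply/rowP => i; rewrite (ord1 i) !mxE eqxx mulr1n.
by congr (v _ _); exact: val_inj.
Qed.

Lemma measurable_rV_split n : measurable_fun [set: 'rV[R]_n.+1] (@rV_split n).
Proof.
apply/measurable_fun_pairP; split; first exact: (@measurable_coord R n.+1).
apply: measurable_fun_rV => i; rewrite /comp /=.
under eq_fun do rewrite mxE.
exact: (@measurable_coord R n.+1).
Qed.

(** Needed for Tonelli's theorem; the exhausting sets of the product are pulled
    back through the bijection [rV_split]. *)
Lemma lebesgue_rV_sigma_finite n : sigma_finite setT (lebesgue_rV R n).
Proof.
elim: n => [|n].
  apply: fin_num_fun_sigma_finite; first by rewrite measure0.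
  by move=> A mA; exact: fin_num_measure.
move=> /sigma_finiteP[G [TG ndG Gfin]].
have /sigma_finiteP[F [TF ndF Ffin]] := sigma_finiteT (@lebesgue_measure R).
have mFG k : measurable (F k `*` G k).
  by apply: measurableX; [have [] := Ffin k|have [] := Gfin k].
exists (fun k => @rV_split n @^-1` (F k `*` G k)).
  apply/esym; rewrite -subTset => v _.
  have [i _ Fi] : (\bigcup_k F k) (rV_split v).1 by rewrite -TF.
  have [j _ Gj] : (\bigcup_k G k) (rV_split v).2 by rewrite -TG.
  exists (maxn i j) => //; split.
    by move: Fi; exact/subsetPset/ndF/leq_maxl.
  by move: Gj; exact/subsetPset/ndG/leq_maxr.
move=> k; split.
  by rewrite -[X in measurable X]setTI; exact: measurable_rV_split.
rewrite /= /pushforward -comp_preimage.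
have -> : @rV_split n \o @rV_cons R n = id by apply/funext => p; exact: rV_consK.
have [? ?] := Ffin k; have [? ?] := Gfin k.
by rewrite product_measure2E// lte_mul_pinfty// ge0_fin_numE.
Qed.

(** A constant of its own, to which the sigma-finiteness structure can be
    attached. *)
Definition lebesgue_rV_fun n : set 'rV[R]_n -> \bar R := lebesgue_rV R n.

HB.instance Definition _ n := Measure.copy (@lebesgue_rV_fun n) (lebesgue_rV R n).

HB.instance Definition _ n := @Measure_isSigmaFinite.Build _ _ _
  (@lebesgue_rV_fun n) (lebesgue_rV_sigma_finite n).

Section tonelli.
Variables (n : nat) (f : 'rV[R]_n.+1 -> \bar R).
Hypotheses (mf : measurable_fun setT f) (f0 : forall v, 0 <= f v).

Let mfc : measurable_fun setT (f \o @rV_cons R n).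
Proof. exact: measurableT_comp mf (@measurable_rV_cons R n). Qed.

Let f0c p : 0 <= (f \o @rV_cons R n) p.
Proof. exact: f0. Qed.

Lemma ge0_integral_rVS1 : \int[lebesgue_rV R n.+1]_v f v =
  \int[lebesgue_measure]_a \int[lebesgue_rV R n]_v f (rV_cons (a, v)).
Proof.
rewrite ge0_integral_pushforward//; last exact: measurable_rV_cons.
rewrite preimage_setT.
rewrite -[RHS](fubini_tonelli1 (m2 := @lebesgue_rV_fun n) (f \o @rV_cons R n) mfc f0c).
apply: eq_measure_integral => A mA _; apply/esym.
apply: product_measure_unique => // A1 A2 mA1 mA2; exact: product_measure2E.
Qed.

Lemma ge0_integral_rVS2 : \int[lebesgue_rV R n.+1]_v f v =
  \int[lebesgue_rV R n]_v \int[lebesgue_measure]_a f (rV_cons (a, v)).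
Proof.
rewrite ge0_integral_rVS1;
exact: (fubini_tonelli (m2 := @lebesgue_rV_fun n) (f \o @rV_cons R n) mfc f0c).
Qed.

End tonelli.

End iterated_integrals.

(** * Schur complements *)

Section schur_complement.
Context (R : realType).

(** The Schur complement of the upper left entry. It is written entrywise so that
    its continuity and measurability follow from those of the entries. *)
Definition schur n (A : 'M[R]_n.+1) : 'M[R]_n :=
  \matrix_(i, j) (A (lift ord0 i) (lift ord0 j) -
    A (lift ord0 i) ord0 * A ord0 (lift ord0 j) / A ord0 ord0).

Definition positive_definite n (A : 'M[R]_n) :=
  forall v : 'rV[R]_n, v != 0 -> 0 < dot (v *m A) v.

Lemma rV_cons0 n (p : measurableTypeR R * 'rV[R]_n) : rV_cons p ord0 ord0 = p.1.
Proof.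
have -> : (ord0 : 'I_n.+1) = lshift n (ord0 : 'I_1) by exact: val_inj.
by rewrite [LHS]row_mxEl mxE.
Qed.

Lemma rV_consS n (p : measurableTypeR R * 'rV[R]_n) j :
  rV_cons p ord0 (lift ord0 j) = p.2 ord0 j.
Proof.
have -> : lift ord0 j = rshift 1 j by exact: val_inj.
exact: row_mxEr.
Qed.

Lemma mul_rV_cons n k (h : 'rV[R]_n) (M : 'M[R]_n.+1) j :
  (rV_cons (k, h) *m M) ord0 j =
  k * M ord0 j + \sum_i h ord0 i * M (lift ord0 i) j.
Proof.
rewrite mxE big_ord_recl rV_cons0; congr (_ + _).
by apply: eq_bigr => i _; rewrite rV_consS.
Qed.

Lemma dot_rV_cons n (p q : measurableTypeR R * 'rV[R]_n) :
  dot (rV_cons p) (rV_cons q) = p.1 * q.1 + dot p.2 q.2.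
Proof.
rewrite /dot big_ord_recl !rV_cons0; congr (_ + _).
by apply: eq_bigr => i _; rewrite !rV_consS.
Qed.

(** Gaussian elimination of the first unknown: if the first coordinate of
    [v *m M] vanishes, the first coordinate of [v] is determined by the others,
    and substituting it turns [M] into its Schur complement. *)
Lemma schur_elim n k (h : 'rV[R]_n) (M : 'M[R]_n.+1) j : M ord0 ord0 != 0 ->
  (rV_cons (k, h) *m M) ord0 ord0 = 0 ->
  (rV_cons (k, h) *m M) ord0 (lift ord0 j) = (h *m schur M) ord0 j.
Proof.
move=> M0; rewrite !mul_rV_cons => /eqP; rewrite addr_eq0 => /eqP kM.
have -> : k = - (\sum_i h ord0 i * M (lift ord0 i) ord0) / M ord0 ord0.
  by rewrite -kM mulfK.
rewrite mxE mulNr mulNr addrC mulr_suml mulr_suml -sumrB.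
by apply: eq_bigr => i _; rewrite !mxE; field.
Qed.

Lemma positive_definite00 n (A : 'M[R]_n.+1) :
  positive_definite A -> 0 < A ord0 ord0.
Proof.
move=> /(_ (rV_cons (1, 0))).
have -> : rV_cons ((1, 0) : R * 'rV[R]_n) != 0.
  apply/eqP => /rowP/(_ ord0)/eqP; rewrite rV_cons0 mxE.
  exact/negP/oner_neq0.
move=> /(_ isT); rewrite /dot big_ord_recl big1 => [|i _]; last first.
  by rewrite rV_consS [X in _ * X]mxE mulr0.
rewrite addr0 rV_cons0 mulr1 mul_rV_cons mul1r big1 ?addr0// => i _.
by rewrite mxE mul0r.
Qed.

(** The quadratic form of the Schur complement at [h] is that of [A] at the
    vector [(k, h)] whose image under [A] has vanishing first coordinate. *)
Lemma positive_definite_schur n (A : 'M[R]_n.+1) :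
  positive_definite A -> positive_definite (schur A).
Proof.
move=> Apos h h0; have A0 := positive_definite00 Apos.
pose k := - (\sum_i h ord0 i * A (lift ord0 i) ord0) / A ord0 ord0.
have v0 : rV_cons (k, h) != 0.
  apply: contra h0 => /eqP/rowP v0; apply/eqP/rowP => j.
  by have := v0 (lift ord0 j); rewrite rV_consS !mxE.
have vA0 : (rV_cons (k, h) *m A) ord0 ord0 = 0.
  by rewrite mul_rV_cons /k divfK ?gt_eqF// addrC subrr.
have := Apos _ v0; rewrite /dot big_ord_recl vA0 mul0r add0r.
congr (_ < _); apply: eq_bigr => j _.
by rewrite rV_consS schur_elim// gt_eqF.
Qed.

Lemma det_schur n (A : 'M[R]_n.+1) : A ord0 ord0 != 0 ->
  \det A = A ord0 ord0 * \det (schur A).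
Proof.
move=> A0.
pose L : 'M[R]_(1 + n) :=
  block_mx 1%:M 0 (\col_i (A (lift ord0 i) ord0 / A ord0 ord0)) 1%:M.
pose U : 'M[R]_(1 + n) :=
  block_mx (A ord0 ord0)%:M (\row_j A ord0 (lift ord0 j)) 0 (schur A).
have l0 (i : 'I_1) : lshift n i = ord0 :> 'I_n.+1.
  by rewrite (ord1 i); exact: val_inj.
have lS (i : 'I_n) : rshift 1 i = lift ord0 i :> 'I_n.+1 by exact: val_inj.
have ALU : A = L *m U.
  rewrite [RHS]mulmx_block !mul1mx !mul0mx !addr0.
  apply: etrans (esym (@submxK _ 1 n 1 n A)) _; congr block_mx.
  - by apply/matrixP => i j; rewrite (ord1 i) (ord1 j) !mxE !l0 eqxx mulr1n.
  - by apply/matrixP => i j; rewrite !mxE l0 lS.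
  - apply/matrixP => i j; rewrite (ord1 j) !mxE l0 lS big_ord1 !mxE eqxx mulr1n.
    by rewrite divfK.
  - apply/matrixP => i j; rewrite !mxE !lS big_ord1 !mxE.
    by field.
by rewrite [in LHS]ALU det_mulmx [X in X * _](@det_lblock _ 1 n)
  [X in _ * X](@det_ublock _ 1 n)
  !det1 !mul1r det_scalar1.
Qed.

Lemma positive_definite_det_gt0 n (A : 'M[R]_n) : positive_definite A -> 0 < \det A.
Proof.
elim: n A => [A _|n IH A Apos]; first by rewrite det_mx00.
have A0 := positive_definite00 Apos.
rewrite det_schur ?gt_eqF// mulr_gt0// IH//.
exact: positive_definite_schur.
Qed.

End schur_complement.

(** * Continuity of maps to row vectors *)

Section row_vector_continuity.
Context (R : realType).

Lemma cvg_rV (T : Type) (F : set_system T) (FF : Filter F) n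
    (f : T -> 'rV[R]_n) (l : 'rV[R]_n) :
  (forall i, f x ord0 i @[x --> F] --> l ord0 i) -> f @ F --> l.
Proof.
move=> fl; apply/cvg_ballP => e e0.
have fe : \forall x \near F, forall i, ball (l ord0 i) e (f x ord0 i).
  apply: filter_forall => i.
  by have /cvg_ballP/(_ e e0) := fl i.
near=> x; split => // i j; rewrite (ord1 i).
by move: j; near: x.
Unshelve. all: by end_near. Qed.

Lemma continuous_rV_cons n (a : R) : continuous (fun v : 'rV[R]_n => rV_cons (a, v)).
Proof.
move=> v; apply: (cvg_rV (nbhs_filter v)) => i; have [j ->|->] := unliftP ord0 i.
  rewrite rV_consS/=; under eq_fun do rewrite rV_consS/=.
  exact: coord_continuous.
by rewrite rV_cons0/=; under eq_fun do rewrite rV_cons0/=; exact: cvg_cst.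
Qed.

Lemma continuous_rV_consl n (v : 'rV[R]_n) : continuous (fun a : R => rV_cons (a, v)).
Proof.
move=> a; apply: (cvg_rV (nbhs_filter a)) => i; have [j ->|->] := unliftP ord0 i.
  by rewrite rV_consS/=; under eq_fun do rewrite rV_consS/=; exact: cvg_cst.
by rewrite rV_cons0/=; under eq_fun do rewrite rV_cons0/=; exact: cvg_id.
Qed.

Lemma rV_consB n (p q : measurableTypeR R * 'rV[R]_n) :
  rV_cons p - rV_cons q = rV_cons ((p.1 : R) - q.1, p.2 - q.2).
Proof.
apply/rowP => i; rewrite [LHS]mxE [X in _ + X]mxE; have [j ->|->] := unliftP ord0 i.
  by rewrite !rV_consS/= !mxE.
by rewrite !rV_cons0.
Qed.

(** Caratheodory's criterion: [u] is differentiable at [x] as soon as its slopes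
    from [x] extend continuously to [x]. *)
Lemma is_derive_slope (u m : R -> R) x a : {for x, continuous m} -> m x = a ->
  (\forall z \near x, u z - u x = (z - x) * m z) -> is_derive x (1 : R) u a.
Proof.
move=> cm mx um; have cv : h^-1 *: (u (h + x) - u x) @[h --> 0^'] --> a.
  have : m (h + x) @[h --> 0^'] --> a.
    rewrite -mx; apply: continuous_cvg; first exact: cm.
    rewrite -{2}[x]add0r; apply: cvgD; last exact: cvg_cst.
    exact: cvg_within.
  apply: cvg_trans; apply: near_eq_cvg.
  have : \forall h \near (0 : R), u (h + x) - u x = h * m (h + x).
    have hx : h + x @[h --> (0 : R)] --> x.
      rewrite -{2}[x]add0r; apply: cvgD; [exact: cvg_id|exact: cvg_cst].
    have hum : \forall h \near (0 : R),
      u (h + x) - u x = (h + x - x) * m (h + x) := hx _ um.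
    by apply: filterS hum => h; rewrite addrK.
  move=> /nbhs_dnbhs um0; near=> h.
  have -> : u (h + x) - u x = h * m (h + x).
    by near: h; exact: um0.
  by rewrite /GRing.scale/= mulKf//; near: h; exact: nbhs_dnbhs_neq.
have cv' : h^-1 *: ((u \o shift x) (h *: 1) - u x) @[h --> 0^'] --> a.
  by under eq_fun do rewrite /= /GRing.scale/= mulr1.
apply: DeriveDef.
  by apply/cvg_ex; exists a.
exact/cvg_lim.
Unshelve. all: by end_near. Qed.

End row_vector_continuity.

(** * Gradients of superlinear convex functions *)

Section partial_legendre.
Context (R : realType).

(** Differentiability of [T] at [x] with Jacobian [A], in Caratheodory's form:
    the increments of [T] are given exactly by a matrix that is continuous at [x].
    Without a remainder term, eliminating a coordinate is pure algebra. *)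
Definition caratheodory_at n (T : 'rV[R]_n -> 'rV[R]_n) (x : 'rV[R]_n) (A : 'M[R]_n) :=
  exists M : 'rV[R]_n -> 'M[R]_n,
  [/\ forall i j, {for x, continuous (fun z => M z i j)}, M x = A &
      \forall z \near x, T z - T x = (z - x) *m M z].

(** The class of maps on which the induction on the dimension runs: [T] and [H]
    play the parts of the gradient and the Hessian of the convex function [Phi].
    Each field is stated so that it passes to partial Legendre transforms by an
    algebraic computation. In particular [T] is only required to be a selection
    of subgradients of [Phi], and [superlinear] says that the Legendre transform
    of [Phi] is finite. *)
Record convex_gradient n (Phi : 'rV[R]_n -> R) (T : 'rV[R]_n -> 'rV[R]_n)
    (H : 'rV[R]_n -> 'M[R]_n) : Prop := ConvexGradient {
  subgradient : forall x z, Phi x + dot (T x) (z - x) <= Phi z;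
  superlinear : forall y, exists C, forall x, dot x y - C <= Phi x;
  gradient_caratheodory : forall x, caratheodory_at T x (H x);
  hessian_continuous : forall i j, continuous (fun x => H x i j);
  hessian_positive : forall x, positive_definite (H x) }.

Lemma caratheodory_continuous n (T : 'rV[R]_n -> 'rV[R]_n) x A j :
  caratheodory_at T x A -> {for x, continuous (fun z => T z ord0 j)}.
Proof.
move=> [M [cM _ TM]].
have ct i : (fun z : 'rV[R]_n => (z ord0 i - x ord0 i) * M z i j) @ x -->
    (x ord0 i - x ord0 i) * M x i j.
  apply: (cvgM (FF := nbhs_filter x)); last exact: cM.
  by apply: (cvgB (FF := nbhs_filter x)); [exact: coord_continuous|exact: cvg_cst].
have cS : (fun z : 'rV[R]_n => \sum_i (z ord0 i - x ord0 i) * M z i j) @ x -->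
    (0 : R).
  rewrite [X in _ --> X](_ : _ = \sum_i (x ord0 i - x ord0 i) * M x i j); last first.
    by rewrite big1// => i _; rewrite subrr mul0r.
  by apply: (cvg_big _ (nbhs_filter x)) => [|i _]; [exact: add_continuous|exact: ct].
pose S (z : 'rV[R]_n) := T x ord0 j + \sum_i (z ord0 i - x ord0 i) * M z i j.
have cvgS : S @ x --> T x ord0 j.
  rewrite -[X in _ --> X]addr0.
  apply: (cvgD (FF := nbhs_filter x)); [exact: cvg_cst|exact: cS].
have ST : {near nbhs x, S =1 (fun z => T z ord0 j)}.
  apply: (@filterS _ _ (nbhs_filter x) _ _ _ TM) => z /rowP/(_ j) Tz.
  have -> : T z ord0 j = T x ord0 j + (T z - T x) ord0 j.
    by rewrite !mxE subrKC.
  by rewrite Tz mxE; congr (_ + _); apply: eq_bigr => i _; rewrite !mxE.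
exact: cvg_trans (near_eq_cvg (FF := nbhs_filter x) ST) cvgS.
Qed.

Lemma convex_gradient_continuous n (Phi : 'rV[R]_n -> R) T H :
  convex_gradient Phi T H -> forall j, continuous (fun z => T z ord0 j).
Proof.
by move=> cg j x; exact: caratheodory_continuous (gradient_caratheodory cg x).
Qed.

Section fixed.
Variables (n : nat) (Phi : 'rV[R]_n.+1 -> R) (T : 'rV[R]_n.+1 -> 'rV[R]_n.+1)
  (H : 'rV[R]_n.+1 -> 'M[R]_n.+1).
Hypothesis cg : convex_gradient Phi T H.
Implicit Types (v : 'rV[R]_n) (a b : R).

Lemma first_is_derive v a :
  is_derive a (1 : R) (fun a => T (rV_cons (a, v)) ord0 ord0)
    (H (rV_cons (a, v)) ord0 ord0).
Proof.
have [M [cM MH TM]] := gradient_caratheodory cg (rV_cons (a, v)).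
apply: (@is_derive_slope _ _ (fun b => M (rV_cons (b, v)) ord0 ord0)).
- apply: (@continuous_comp _ _ _ (fun b : R => rV_cons (b, v))
    (fun z => M z ord0 ord0)); [exact: continuous_rV_consl|exact: cM].
- by rewrite MH.
- have TMv : \forall b \near a, T (rV_cons (b, v)) - T (rV_cons (a, v)) =
      (rV_cons (b, v) - rV_cons (a, v)) *m M (rV_cons (b, v)).
    exact: (@continuous_rV_consl R n v a _ TM).
  apply: (@filterS _ _ (nbhs_filter a) _ _ _ TMv) => b /= /rowP/(_ ord0).
  rewrite rV_consB/= subrr mul_rV_cons [X in _ = _ + X]big1 ?addr0; last first.
    by move=> i _; rewrite mxE mul0r.
  by move=> <-; rewrite !mxE.
Qed.

Lemma first_continuous v : continuous (fun a => T (rV_cons (a, v)) ord0 ord0).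
Proof.
by move=> a; apply: differentiable_continuous; apply/derivable1_diffP;
  have [] := first_is_derive v a.
Qed.

Lemma first_mono v :
  {mono (fun a => T (rV_cons (a, v)) ord0 ord0) : a b / a <= b}.
Proof.
apply: le_mono => a b ab; rewrite -subr_gt0.
have [|c _ ->] := MVT ab (fun x _ => first_is_derive v x).
  by apply: continuous_subspaceT; exact: first_continuous.
rewrite mulr_gt0// ?subr_gt0//.
exact/positive_definite00/(hessian_positive cg).
Qed.

(** If [T_1 (a, v)] stayed below [b] as [a] grows, the subgradient inequality
    between [(a, v)] and [(0, v)] would bound [Phi (a, v)] by [b a] up to a
    constant, whereas [superlinear] gives growth at least [(b + 1) a]. The same
    argument with [b - 1] applies as [a] decreases, and the intermediate value
    theorem concludes. *)
Lemma first_surjective v b : exists a, T (rV_cons (a, v)) ord0 ord0 = b.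
Proof.
have sub0 a : Phi (rV_cons (a, v)) - a * T (rV_cons (a, v)) ord0 ord0 <=
    Phi (rV_cons (0, v)).
  apply: le_trans (subgradient cg (rV_cons (a, v)) _).
  rewrite rV_consB/= subrr -{2}[T _](rV_splitK) dot_rV_cons/= /dot big1.
    by rewrite addr0 lerD2l sub0r mulrN mulrC.
  by move=> i _; rewrite [X in _ * X]mxE mulr0.
have [C1 PhiC1] := superlinear cg (rV_cons (b + 1, 0)).
have [C2 PhiC2] := superlinear cg (rV_cons (b - 1, 0)).
have dotE a c : dot (rV_cons (a, v)) (rV_cons (c, 0)) = a * c.
  by rewrite dot_rV_cons/= /dot big1 ?addr0// => i _; rewrite mxE mulr0.
set P0 := Phi (rV_cons (0, v)) in sub0.
have [a1 ba1] : exists a, b <= T (rV_cons (a, v)) ord0 ord0.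
  exists (`|P0 + C1| + 1); set a := _ + 1.
  have := sub0 a; have := PhiC1 (rV_cons (a, v)); rewrite dotE.
  set t := T _ _ _; set p := Phi _ => Cp pP; rewrite leNgt; apply/negP => tb.
  have : a <= P0 + C1.
    have : a * t <= a * b by apply: ler_wpM2l; [rewrite /a addr_ge0|exact: ltW].
    by move: Cp pP; rewrite mulrDr mulr1; lra.
  by apply/negP; rewrite -ltNge /a (le_lt_trans (ler_norm _))// ltrDl.
have [a2 ba2] : exists a, T (rV_cons (a, v)) ord0 ord0 <= b.
  exists (- (`|P0 + C2| + 1)); set a := _ + 1.
  have := sub0 (- a); have := PhiC2 (rV_cons (- a, v)); rewrite dotE.
  set t := T _ _ _; set p := Phi _ => Cp pP; rewrite leNgt; apply/negP => tb.
  have : a <= P0 + C2.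
    have : a * b <= a * t by apply: ler_wpM2l; [rewrite /a addr_ge0|exact: ltW].
    by move: Cp pP; rewrite mulrBr mulr1 !mulNr; lra.
  by apply/negP; rewrite -ltNge /a (le_lt_trans (ler_norm _))// ltrDl.
have a21 : a2 <= a1 by rewrite -(first_mono v) (le_trans ba2).
have [||a _ ab] := @IVT R (fun a => T (rV_cons (a, v)) ord0 ord0) a2 a1 b a21.
- by apply: continuous_subspaceT; exact: first_continuous.
- by rewrite ge_min ba2/= le_max ba1 orbT.
- by exists a.
Qed.

End fixed.
End partial_legendre.

(** * Partial Legendre transform *)

Section partial_legendre2.
Context (R : realType).
Variables (n : nat) (Phi : 'rV[R]_n.+1 -> R) (T : 'rV[R]_n.+1 -> 'rV[R]_n.+1)
  (H : 'rV[R]_n.+1 -> 'M[R]_n.+1).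
Hypothesis cg : convex_gradient Phi T H.
Variable g : R -> 'rV[R]_n -> R.
Hypothesis gK : forall y v, T (rV_cons (g y v, v)) ord0 ord0 = y.

Lemma first_inverseK v a : g (T (rV_cons (a, v)) ord0 ord0) v = a.
Proof. by apply: (inc_inj (first_mono cg v)); rewrite gK. Qed.

Definition solve_first (w : 'rV[R]_n.+1) : 'rV[R]_n.+1 :=
  rV_cons (g (w ord0 ord0) (rV_split w).2, (rV_split w).2).

Lemma solve_first_cons y v : solve_first (rV_cons (y, v)) = rV_cons (g y v, v).
Proof. by rewrite /solve_first rV_cons0 rV_consK. Qed.

(** Continuity of the implicit function [g] comes from monotonicity: [g] lies
    between [a0 - e] and [a0 + e] exactly when the first coordinate of [T] at
    these two abscissas lies on either side of the prescribed value, and this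
    condition is open. *)
Lemma continuous_solve_first : continuous solve_first.
Proof.
move=> w0; apply: (cvg_rV (nbhs_filter w0)) => i.
have csplit j : continuous (fun w : 'rV[R]_n.+1 => (rV_split w).2 ord0 j).
  rewrite (_ : (fun w => _) = (fun w : 'rV[R]_n.+1 => w ord0 (lift ord0 j))).
    exact: coord_continuous.
  apply/funext => w; rewrite -{2}[w]rV_splitK; symmetry; exact: rV_consS.
have [j ->|->] := unliftP ord0 i.
  by rewrite rV_consS/=; under eq_fun do rewrite rV_consS/=; exact: csplit.
rewrite rV_cons0/=; under eq_fun do rewrite rV_cons0/=.
set a0 := g _ _.
pose D a (w : 'rV[R]_n.+1) := T (rV_cons (a, (rV_split w).2)) ord0 ord0 - w ord0 ord0.
have cD a : continuous (D a).
  move=> w; apply: (cvgB (FF := nbhs_filter w)); last exact: coord_continuous.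
  apply: (@continuous_comp _ _ _ (fun w : 'rV[R]_n.+1 => rV_cons (a, (rV_split w).2))
    (fun z => T z ord0 ord0)); last exact: convex_gradient_continuous cg _ _.
  apply: (cvg_rV (nbhs_filter w)) => k; have [l ->|->] := unliftP ord0 k.
    by rewrite rV_consS/=; under eq_fun do rewrite rV_consS/=; exact: csplit.
  by rewrite rV_cons0/=; under eq_fun do rewrite rV_cons0/=; exact: cvg_cst.
have Tlt a w : (D a w < 0) = (a < g (w ord0 ord0) (rV_split w).2).
  by rewrite /D subr_lt0 -{1}(gK (w ord0 ord0) (rV_split w).2)
    (leW_mono (first_mono cg _)).
have ltT a w : (0 < D a w) = (g (w ord0 ord0) (rV_split w).2 < a).
  by rewrite /D subr_gt0 -{1}(gK (w ord0 ord0) (rV_split w).2)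
    (leW_mono (first_mono cg _)).
apply/cvgrPdist_lt => e e0.
have lo : \forall w \near w0, D (a0 - e) w < 0.
  by apply: (@cvgr_lt _ _ _ (nbhs_filter w0) _ _ (cD _ w0)); rewrite Tlt ltrBlDr ltrDl.
have hi : \forall w \near w0, 0 < D (a0 + e) w.
  by apply: (@cvgr_gt _ _ _ (nbhs_filter w0) _ _ (cD _ w0)); rewrite ltT ltrDl.
apply: (@filterS2 _ _ (nbhs_filter w0) _ _ _ _ lo hi) => w.
rewrite Tlt ltT => aw wa; rewrite distrC ltr_norml.
by apply/andP; split; lra.
Qed.

(** Once the first coordinate [y] of the image is fixed, the other coordinates
    of [T] form again the gradient of a convex function, namely the partial
    Legendre transform [inf_a (Phi (a, v) - a y)], whose infimum is attained at
    [a = g y v]. Its Hessian is the Schur complement of that of [Phi]. *)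
Lemma slice_convex_gradient y : convex_gradient
  (fun v => Phi (rV_cons (g y v, v)) - g y v * y)
  (fun v => (rV_split (T (rV_cons (g y v, v)))).2)
  (fun v => schur (H (rV_cons (g y v, v)))).
Proof.
pose G v := rV_cons (g y v, v) : 'rV[R]_n.+1.
have cG : continuous G.
  have -> : G = solve_first \o (fun v => rV_cons (y, v)).
    by apply/funext => v /=; rewrite solve_first_cons.
  move=> v; apply: continuous_comp; first exact: continuous_rV_cons.
  exact: continuous_solve_first.
have TG v : T (G v) = rV_cons (y, (rV_split (T (G v))).2).
  apply: etrans (esym (rV_splitK _)) _; congr rV_cons; rewrite [LHS]surjective_pairing.
  by congr (_, _); exact: gK.
have cschur v (M : 'rV[R]_n.+1 -> 'M[R]_n.+1) : M (G v) ord0 ord0 != 0 ->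
    (forall i j, {for G v, continuous (fun z => M z i j)}) ->
    forall i j, {for v, continuous (fun z => schur (M (G z)) i j)}.
  move=> M0 cM i j.
  have cMG k l : M (G z) k l @[z --> v] --> M (G v) k l.
    by apply: (@continuous_comp _ _ _ G (fun z => M z k l)); [exact: cG|exact: cM].
  rewrite /prop_for /continuous_at mxE; under eq_fun do rewrite mxE.
  apply: (cvgB (FF := nbhs_filter v)); first exact: cMG.
  apply: (cvgM (FF := nbhs_filter v)).
    by apply: (cvgM (FF := nbhs_filter v)); exact: cMG.
  by apply: (cvgV (FF := nbhs_filter v)) => //; exact: cMG.
have H0 v : H v ord0 ord0 != 0.
  by rewrite gt_eqF//; exact/positive_definite00/(hessian_positive cg).
split.
- move=> x z; have := subgradient cg (G x) (G z).
  have -> : dot (T (G x)) (G z - G x) =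
      y * (g y z - g y x) + dot (rV_split (T (G x))).2 (z - x).
    by rewrite {1}TG rV_consB dot_rV_cons.
  by rewrite /G; lra.
- move=> v; have [C PhiC] := superlinear cg (rV_cons (y, v)).
  by exists C => x; have := PhiC (G x); rewrite dot_rV_cons/=; lra.
- move=> x; have [M [cM MH TM]] := gradient_caratheodory cg (G x).
  exists (fun z => schur (M (G z))); split.
  + by apply: cschur => //; rewrite MH.
  + by rewrite MH.
  + have M0 : \forall z \near x, M (G z) ord0 ord0 != 0.
      have c0 : M (G z) ord0 ord0 @[z --> x] --> H (G x) ord0 ord0.
        rewrite -MH; apply: (@continuous_comp _ _ _ G (fun z => M z ord0 ord0)).
          exact: cG.
        exact: cM.
      by apply: (@cvgr_neq0 _ _ _ _ (nbhs_filter x) _ _ c0); exact: H0.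
    have TMG : \forall z \near x, T (G z) - T (G x) = (G z - G x) *m M (G z).
      exact: cG _ TM.
    apply: (@filterS2 _ _ (nbhs_filter x) _ _ _ _ M0 TMG) => z Mz0.
    rewrite [in LHS]TG [in X in _ - X]TG !rV_consB/= subrr => TGz.
    apply/rowP => j.
    rewrite -(schur_elim _ _ (k := g y z - g y x))// -TGz ?rV_consS ?rV_cons0//.
- by move=> i j x; apply: cschur => // k l; exact: hessian_continuous cg _ _ _.
- by move=> x; exact/positive_definite_schur/(hessian_positive cg).
Qed.

End partial_legendre2.

(** * Change of variables by a convex gradient *)

Section change_of_variables.
Local Open Scope ereal_scope.
Context (R : realType).

Lemma continuous_measurable_fun_rV m n (F : 'rV[R]_m -> 'rV[R]_n) :
  (forall i, continuous (fun x => F x ord0 i)) -> measurable_fun setT F.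
Proof.
move=> cF; apply: measurable_fun_rV => i.
exact: continuous_measurable_rV (cF i).
Qed.

Lemma measurable_fun_det d (X : measurableType d) n (A : X -> 'M[R]_n) :
  (forall i j, measurable_fun setT (fun x => A x i j)) ->
  measurable_fun setT (fun x => \det (A x)).
Proof.
move=> mA; apply: measurable_sum => s; apply: measurable_funM => //.
by apply: measurable_prod => i _; exact: mA.
Qed.

(** Induction on the dimension. For fixed trailing coordinates [v], the
    substitution [y = T_1 (a, v)] in the innermost integral uses up the factor
    [H_11] of [det H = H_11 * det (schur H)]; exchanging the order of
    integration, for each [y] what remains is the same statement for the slice
    [slice_convex_gradient]. *)
Lemma ge0_integral_convex_gradient n (Phi : 'rV[R]_n -> R) T H
    (f : 'rV[R]_n -> \bar R) :
  convex_gradient Phi T H -> measurable_fun setT f -> (forall y, 0 <= f y) ->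
  \int[lebesgue_rV R n]_x (f (T x) * (\det (H x))%:E) =
  \int[lebesgue_rV R n]_y f y.
Proof.
elim: n Phi T H f => [|n IH] Phi T H f cg mf f0.
  apply: eq_integral => x _; rewrite det_mx00 mule1; congr (f _).
  by apply/rowP => -[].
have [g gK] : exists g : R -> 'rV[R]_n -> R,
    forall y v, T (rV_cons (g y v, v)) ord0 ord0 = y.
  have /choice[g gK] : forall p : R * 'rV[R]_n, exists a,
      T (rV_cons (a, p.2)) ord0 ord0 = p.1.
    by move=> p; exact: first_surjective cg _ _.
  by exists (fun y v => g (y, v)) => y v; exact: gK (y, v).
have H00 x : (0 < H x ord0 ord0)%R.
  exact/positive_definite00/(hessian_positive cg).
have detS0 x : (0 <= \det (schur (H x)))%R.
  apply/ltW/positive_definite_det_gt0/positive_definite_schur.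
  exact: hessian_positive cg _.
have mT : measurable_fun setT T.
  by apply: continuous_measurable_fun_rV => i; exact: convex_gradient_continuous cg _.
have mH i j : measurable_fun setT (fun x => H x i j).
  by apply: continuous_measurable_rV; exact: hessian_continuous cg _ _.
have mH00V : measurable_fun setT (fun x => (H x ord0 ord0)^-1%R).
  apply: continuous_measurable_rV => x.
  apply: (cvgV (FF := nbhs_filter x)); first by rewrite gt_eqF.
  exact: hessian_continuous cg _ _ _.
have mdetS : measurable_fun setT (fun x => \det (schur (H x))).
  apply: measurable_fun_det => i j; under eq_fun do rewrite mxE.
  by apply: measurable_funB => //; do 2! apply: measurable_funM => //.
pose G := solve_first g.
have mG : measurable_fun setT G.
  apply: continuous_measurable_fun_rV => i x.
  apply: (@continuous_comp _ _ _ G (fun z => z ord0 i)); last exact: coord_continuous.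
  exact: (continuous_solve_first cg gK).
pose F x := f (T x) * (\det (schur (H x)))%:E.
have mF : measurable_fun setT F.
  apply: emeasurable_funM; last exact/measurable_EFinP.
  exact: measurableT_comp.
have F0 x : 0 <= F x by rewrite mule_ge0// lee_fin.
have mFG : measurable_fun setT (F \o G) by exact: measurableT_comp.
transitivity (\int[lebesgue_rV R n.+1]_w (F \o G) w).
  have detE x : f (T x) * (\det (H x))%:E = F x * (H x ord0 ord0)%:E.
    by rewrite /F det_schur ?gt_eqF// -muleA -EFinM mulrC.
  under eq_integral do rewrite detE.
  have F'0 x : 0 <= F x * (H x ord0 ord0)%:E by rewrite mule_ge0// lee_fin ltW.
  have mF' : measurable_fun setT (fun x => F x * (H x ord0 ord0)%:E).
    by apply: emeasurable_funM => //; exact/measurable_EFinP.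
  rewrite (ge0_integral_rVS2 mF' F'0) (ge0_integral_rVS2 mFG) => [|v]; last exact: F0.
  apply: eq_integral => v _.
  have mcons : measurable_fun [set: measurableTypeR R] (fun a => rV_cons (a, v)).
    exact: measurableT_comp (@measurable_rV_cons R n) (pair2_measurable v).
  have mFGv := measurableT_comp mFG mcons.
  have ca : continuous (fun a : R => H (rV_cons (a, v)) ord0 ord0).
    move=> a; apply: (@continuous_comp _ _ _ (fun a : R => rV_cons (a, v))
      (fun x => H x ord0 ord0)); first exact: continuous_rV_consl.
    exact: hessian_continuous cg _ _ _.
  rewrite -(@ge0_integral_substitution_line _ _ _ (g ^~ v) _ (first_is_derive cg v)
    ca (fun a => H00 _) _ _ mFGv).
  - apply: eq_integral => a _ /=.
    by rewrite /G solve_first_cons (first_inverseK cg gK).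
  - by move=> a; exact: (first_inverseK cg gK).
  - by move=> y; exact: gK.
  - by move=> a; exact: F0.
rewrite (ge0_integral_rVS1 mFG) => [|v]; last exact: F0.
rewrite (ge0_integral_rVS1 mf)//; apply: eq_integral => y _.
have mfy : measurable_fun setT (fun v : 'rV[R]_n => f (rV_cons (y, v))).
  apply: (measurableT_comp mf).
  exact: measurableT_comp (@measurable_rV_cons R n) (pair1_measurable y).
rewrite -(IH _ _ _ _ (slice_convex_gradient cg gK y) mfy)//.
apply: eq_integral => v _ /=; rewrite /F /G solve_first_cons; congr (f _ * _).
apply: etrans (esym (rV_splitK _)) _; congr rV_cons; rewrite [LHS]surjective_pairing.
by congr (_, _); exact: gK.
Qed.

End change_of_variables.

(** * Integrals of functions with an integrable minorant *)

Section minorized_integrals.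
Local Open Scope ereal_scope.
Context d (T : measurableType d) (R : realType) (mu : {measure set T -> \bar R}).
Implicit Types f g : T -> R.

Let posE (s : T -> R) x : (EFin \o s)^\+ x = (Num.max (s x) 0)%:E.
Proof. by rewrite funeposE EFin_max. Qed.

Let negE (s : T -> R) x : (EFin \o s)^\- x = (Num.max (- s x) 0)%:E.
Proof. by rewrite funenegE EFin_max. Qed.

(** Functions with an integrable minorant: their integral is well defined,
    possibly [+oo], and is additive and monotone. The functional [J] is a sum of
    integrals of such functions. *)
Definition minorized f := measurable_fun setT f /\
  exists g, mu.-integrable setT (EFin \o g) /\ forall x, (g x <= f x)%R.

(** The identity [f^+ + g^- = f^- + g^+ + (f - g)] involves only nonnegative
    functions, so its integral splits; the terms [g^+], [g^-] and [f^-] have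
    finite integrals and can be moved across. *)
Let integral_split f g : measurable_fun setT f ->
  mu.-integrable setT (EFin \o g) -> (forall x, g x <= f x)%R ->
  \int[mu]_x (f x)%:E = \int[mu]_x (g x)%:E + \int[mu]_x (f x - g x)%:E.
Proof.
move=> mf ig gf; have mg : measurable_fun setT g.
  exact/measurable_EFinP/(measurable_int mu).
have mp (s : T -> R) : measurable_fun setT s ->
    measurable_fun setT (fun x => (Num.max (s x) 0)%:E : \bar R).
  by move=> ms; apply/measurable_EFinP; exact: measurable_maxr.
have mn (s : T -> R) : measurable_fun setT s ->
    measurable_fun setT (fun x => (Num.max (- s x) 0)%:E : \bar R).
  by move=> ms; apply/mp; exact: measurableT_comp.
rewrite integralE [X in _ = X + _]integralE.
have gpos := integrable_pos_fin_num measurableT ig.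
have gneg := integrable_neg_fin_num measurableT ig.
have : \int[mu]_x (EFin \o f)^\+ x + \int[mu]_x (EFin \o g)^\- x =
    \int[mu]_x (EFin \o f)^\- x + \int[mu]_x (EFin \o g)^\+ x + \int[mu]_x (f x - g x)%:E.
  under eq_integral do rewrite posE.
  under [X in _ + X = _]eq_integral do rewrite negE.
  under [X in _ = X + _ + _]eq_integral do rewrite negE.
  under [X in _ = _ + X + _]eq_integral do rewrite posE.
  have mfg : measurable_fun setT (fun x => (f x - g x)%:E).
    by apply/measurable_EFinP; exact: measurable_funB.
  have max0 (r : R) : 0 <= (Num.max r 0)%:E by rewrite lee_fin le_max lexx orbT.
  rewrite -!ge0_integralD//=.
  - apply: eq_integral => x _; rewrite -!EFinD; congr (_%:E).
    have := gf x; rewrite /Num.max.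
    by do 4! case: ifPn; rewrite ?ltNge ?negbK; lra.
  - by move=> x _; rewrite adde_ge0.
  - by apply: emeasurable_funD; [exact: mn|exact: mp].
  - by move=> x _; rewrite lee_fin subr_ge0.
  all: try exact: mp; try exact: mn.
have fneg : \int[mu]_x (EFin \o f)^\- x \is a fin_num.
  rewrite ge0_fin_numE; last exact: integral_ge0.
  apply: le_lt_trans (_ : \int[mu]_x (EFin \o g)^\- x < +oo); last first.
    by rewrite -ge0_fin_numE//; exact: integral_ge0.
  apply: ge0_le_integral => //.
  - exact/measurable_funeneg/measurable_EFinP.
  - exact/measurable_funeneg/measurable_EFinP.
  - move=> x _; rewrite !negE lee_fin; have := gf x; rewrite /Num.max.
    by do 2! case: ifPn; rewrite ?ltNge ?negbK; lra.
move: gpos gneg fneg.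
move: (\int[mu]_x (EFin \o f)^\+ x) (\int[mu]_x (EFin \o f)^\- x) => P A.
move: (\int[mu]_x (EFin \o g)^\+ x) (\int[mu]_x (EFin \o g)^\- x) => C B.
move: (\int[mu]_x (f x - g x)%:E) => K.
move: C B A => [C||] [B||] [A||] //= _ _ _.
case: P => [P||]; case: K => [K||] //= [].
by move=> /eqP; rewrite -subr_eq0 => /eqP PK; rewrite -!EFinB -EFinD; congr (_%:E); lra.
Qed.

Lemma integral_minorized_gtNy f : minorized f -> -oo < \int[mu]_x (f x)%:E.
Proof.
move=> [mf [g [ig gf]]]; rewrite (integral_split mf ig gf).
have /fin_numPlt/andP[gNy _] := integrable_fin_num measurableT ig.
rewrite (lt_le_trans gNy)// leeDl//; apply: integral_ge0 => x _.
by rewrite lee_fin subr_ge0.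
Qed.

Let measurable_fsub f g : measurable_fun setT f -> mu.-integrable setT (EFin \o g) ->
  measurable_fun setT (fun x => (f x - g x)%:E : \bar R).
Proof.
move=> mf ig; apply/measurable_EFinP; apply: measurable_funB => //.
exact/measurable_EFinP/(measurable_int mu).
Qed.

Let integrable_sum g1 g2 : mu.-integrable setT (EFin \o g1) ->
  mu.-integrable setT (EFin \o g2) ->
  mu.-integrable setT (EFin \o (fun x => g1 x + g2 x)%R).
Proof.
move=> ig1 ig2; rewrite (_ : EFin \o _ = (EFin \o g1) \+ (EFin \o g2)).
  exact: integrableD.
by apply/funext => x /=; rewrite EFinD.
Qed.

Let integrable_scale (t : R) g : mu.-integrable setT (EFin \o g) ->
  mu.-integrable setT (EFin \o (fun x => t * g x)%R).
Proof.
move=> ig; rewrite (_ : EFin \o _ = (fun x => t%:E * (EFin \o g) x)).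
  exact: integrableZl.
by apply/funext => x /=; rewrite EFinM.
Qed.

Lemma integral_minorizedD f1 f2 : minorized f1 -> minorized f2 ->
  \int[mu]_x (f1 x + f2 x)%:E = \int[mu]_x (f1 x)%:E + \int[mu]_x (f2 x)%:E.
Proof.
move=> [mf1 [g1 [ig1 gf1]]] [mf2 [g2 [ig2 gf2]]].
have -> : \int[mu]_x (f1 x + f2 x)%:E =
    \int[mu]_x (g1 x + g2 x)%:E + \int[mu]_x (f1 x + f2 x - (g1 x + g2 x))%:E.
  apply: (integral_split (measurable_funD mf1 mf2)) => [|x].
    exact: integrable_sum.
  by rewrite lerD.
rewrite (integral_split mf1 ig1 gf1) (integral_split mf2 ig2 gf2).
apply: etrans (addeACA _ _ _ _); congr (_ + _).
  exact: (integralD measurableT ig1 ig2).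
rewrite -ge0_integralD//; [|
  by move=> x _; rewrite lee_fin subr_ge0| exact: measurable_fsub|
  by move=> x _; rewrite lee_fin subr_ge0| exact: measurable_fsub].
by apply: eq_integral => x _; rewrite -EFinD; congr (_%:E); lra.
Qed.

Lemma le_integral_minorized f1 f2 : minorized f1 -> measurable_fun setT f2 ->
  (forall x, f1 x <= f2 x)%R -> \int[mu]_x (f1 x)%:E <= \int[mu]_x (f2 x)%:E.
Proof.
move=> [mf1 [g [ig gf1]]] mf2 f12.
have gf2 x : (g x <= f2 x)%R by exact: le_trans (f12 x).
rewrite (integral_split mf1 ig gf1) (integral_split mf2 ig gf2) leeD2l//.
apply: ge0_le_integral => //.
- by move=> x _; rewrite lee_fin subr_ge0.
- exact: measurable_fsub.
- exact: measurable_fsub.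
- by move=> x _; rewrite lee_fin lerB.
Qed.

Lemma integral_minorizedZ (t : R) f : (0 <= t)%R -> minorized f ->
  \int[mu]_x (t * f x)%:E = t%:E * \int[mu]_x (f x)%:E.
Proof.
move=> t0 [mf [g [ig gf]]]; have mfg := measurable_fsub mf ig.
have -> : \int[mu]_x (t * f x)%:E =
    \int[mu]_x (t * g x)%:E + \int[mu]_x (t * f x - t * g x)%:E.
  apply: integral_split => [||x]; first exact: measurable_funM.
    exact: integrable_scale.
  by rewrite ler_wpM2l.
rewrite (integral_split mf ig gf) muleDr//; last first.
  by apply: fin_num_adde_defr; exact: integrable_fin_num.
congr (_ + _); first exact: (integralZl measurableT ig).
rewrite -ge0_integralZl_EFin//; last by move=> x _; rewrite lee_fin subr_ge0.
by apply: eq_integral => x _; rewrite -EFinM mulrBr.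
Qed.

Lemma minorizedZ (t : R) f : (0 <= t)%R -> minorized f -> minorized (fun x => t * f x)%R.
Proof.
move=> t0 [mf [g [ig gf]]]; split; first exact: measurable_funM.
exists (fun x => t * g x)%R; split; first exact: integrable_scale.
by move=> x; rewrite ler_wpM2l.
Qed.

Lemma minorizedD f1 f2 : minorized f1 -> minorized f2 ->
  minorized (fun x => f1 x + f2 x)%R.
Proof.
move=> [mf1 [g1 [ig1 gf1]]] [mf2 [g2 [ig2 gf2]]].
split; first exact: measurable_funD.
exists (fun x => g1 x + g2 x)%R; split; first exact: integrable_sum.
by move=> x; rewrite lerD.
Qed.

Lemma minorizedM (c : R) f g : measurable_fun setT f -> (forall x, c <= f x)%R ->
  mu.-integrable setT (EFin \o g) -> (forall x, 0 <= g x)%R ->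
  minorized (fun x => f x * g x)%R.
Proof.
move=> mf cf ig g0; split.
  apply: measurable_funM => //; exact/measurable_EFinP/(measurable_int mu).
exists (fun x => c * g x)%R; split; first exact: integrable_scale.
by move=> x; rewrite ler_wpM2r.
Qed.

End minorized_integrals.

(** * First-order expansions of smooth functions *)

Section smooth_functions.
Local Open Scope convex_scope.
Context (R : realType) (n : nat).
Implicit Types (f : 'rV[R]_n -> R) (x z v : 'rV[R]_n).

Lemma le_coord_norm v i : `|v ord0 i| <= `|v|.
Proof.
rewrite [leRHS]/Num.norm/= mx_normrE.
exact: (le_bigmax _ (fun ij => `|v ij.1 ij.2|) (ord0, i)).
Qed.

Lemma sqr_norm_le_dot v : `|v| ^+ 2 <= dot v v.
Proof.
have dot0 : 0 <= dot v v by apply: sumr_ge0 => i _; rewrite -expr2 sqr_ge0.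
have [->|v0] := eqVneq `|v| 0; first by rewrite expr0n.
have [[i j] /= vE] := mx_norm_neq0 v0.
rewrite [`|v|]/Num.norm/= vE.
rewrite (ord1 i) real_normK ?num_real// /dot (bigD1 j)//= expr2 lerDl.
by apply: sumr_ge0 => k _; rewrite -expr2 sqr_ge0.
Qed.

Lemma differentiable_remainder f x (e : R) : differentiable (f : _ -> R^o) x -> 0 < e ->
  \forall z \near x,
    `|f z - f x - \sum_i (z - x) ord0 i * partial i f x| <= e * `|z - x|.
Proof.
move=> df e0; have /eqaddoP/(_ e e0) rem := diff_locally df.
have cx : (fun z => z - x) @ x --> (0 : 'rV[R]_n).
  rewrite -(subrr x); apply: (cvgB (FF := nbhs_filter x)); last exact: cvg_cst.
  exact: cvg_id.
apply: (@filterS _ _ (nbhs_filter x) _ _ _ (cx _ rem)) => z /=.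
congr (_ <= _); congr (`| _ |).
rewrite !fctE /= subrK opprD addrA; congr (_ - _).
rewrite [in LHS](row_sum_delta (z - x)) linear_sum; apply: eq_bigr => i _.
by rewrite linearZ /= -deriveE.
Qed.

Lemma smooth_continuous f : smooth f -> continuous f.
Proof. by move=> sf x; exact/differentiable_continuous/(sf [::] x). Qed.

(** By convexity the difference quotients [(f (x + t (z - x)) - f x) / t] are at
    most [f z - f x], and they tend to the directional derivative. The accuracy
    [e] is chosen to contradict a strict inequality the other way. *)
Lemma convex_subgradient f x z :
  convex_function [set: convex_lmodType 'rV[R]_n] (f : _ -> R^o) ->
  differentiable (f : _ -> R^o) x ->
  f x + dot (gradient f x) (z - x) <= f z.
Proof.
move=> cf df; rewrite leNgt; apply/negP; set D := dot _ _ => lt.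
pose e := (f x + D - f z) / (`|z - x| + 1).
have n0 : 0 < `|z - x| + 1 by rewrite ltr_wpDl.
have e0 : 0 < e by rewrite divr_gt0// subr_gt0.
have rem := differentiable_remainder df e0.
have ct : (fun t : R => x + t *: (z - x)) @ (0 : R) --> x.
  rewrite -[X in _ --> X]addr0 -(scale0r (z - x)).
  apply: (cvgD (FF := nbhs_filter (0 : R))); first exact: cvg_cst.
  by apply: (cvgZr_tmp (FF := nbhs_filter (0 : R))); exact: cvg_id.
have /nbhs_ballP[r /= r0 rP] := ct _ rem.
pose t := Num.min (r / 2) (2^-1 : R).
have t0 : 0 < t by rewrite lt_min divr_gt0//= invr_gt0.
have t1 : t <= 1 by rewrite ge_min invf_le1 ?ler1n ?orbT.
have tr : t < r by rewrite gt_min ltr_pdivrMr// ltr_pMr// ltr1n.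
have /rP /= : ball (0 : R) r t by rewrite /ball/= sub0r normrN gtr0_norm.
have -> : x + t *: (z - x) - x = t *: (z - x) by rewrite addrC addKr.
have -> : \sum_i (t *: (z - x)) ord0 i * partial i f x = t * D.
  rewrite /D /dot mulr_sumr; apply: eq_bigr => i _; rewrite mxE [gradient _ _ _ _]mxE.
  by rewrite -mulrA; congr (_ * _); rewrite mulrC.
rewrite normrZ gtr0_norm//.
have := cf (Itv01 (ltW t0) t1) z x (in_setT _) (in_setT _).
have -> : (z : convex_lmodType 'rV[R]_n) <| Itv01 (ltW t0) t1 |> x = x + t *: (z - x).
  rewrite /conv/= /unstable.onem scalerBl scale1r scalerBr addrCA; congr (_ + _).
rewrite convRE/= /unstable.onem => fxz; rewrite ler_norml => /andP[fxz2 _].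
have ev : e * `|z - x| < f x + D - f z.
  rewrite /e mulrAC ltr_pdivrMr// ltr_pM2l ?ltrDl ?subr_gt0//.
have : t * (e * `|z - x|) < t * (f x + D - f z) by rewrite ltr_pM2l.
by move: fxz fxz2; rewrite mulrCA; move: (f (x + _)) (e * _) => a b; lra.
Qed.

(** The exact matrix of increments is the Hessian plus a matrix of rank one,
    [(z - x)^T r / |z - x|^2], that absorbs the remainder [r = o(|z - x|)] of the
    first-order expansion of the gradient. At [z = x] it vanishes, since
    [0^-1 = 0]. *)
Lemma smooth_caratheodory f x : smooth f ->
  caratheodory_at (gradient f) x (hessian f x).
Proof.
move=> sf; pose H := hessian f x.
pose r z j := (gradient f z - gradient f x - (z - x) *m H) ord0 j.
pose E z : 'M[R]_n := \matrix_(i, j) ((z - x) ord0 i * r z j / dot (z - x) (z - x)).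
exists (fun z => H + E z).
have dot0 z : dot (z - x) (z - x) = 0 -> z - x = 0.
  move=> d0; apply/eqP; rewrite -normr_eq0 -sqrf_eq0 eq_le sqr_ge0 andbT -d0.
  exact: sqr_norm_le_dot.
split.
- move=> i j; apply/(cvgrPdist_le (FF := nbhs_filter x)) => e e0.
  have := differentiable_remainder (sf [:: j] x) e0.
  apply: (@filterS _ _ (nbhs_filter x)) => z rem.
  rewrite !mxE subrr !mul0r addr0 opprD addNKr normrN.
  have [d0|d0] := eqVneq (dot (z - x) (z - x)) 0.
    by rewrite d0 invr0 mulr0 normr0 ltW.
  have dpos : 0 < dot (z - x) (z - x).
    by rewrite lt_neqAle eq_sym d0; apply: le_trans (sqr_norm_le_dot _); rewrite sqr_ge0.
  rewrite normrM normfV (gtr0_norm dpos) ler_pdivrMr//.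
  apply: (@le_trans _ _ (`|z - x| * (e * `|z - x|))); last first.
    by rewrite mulrCA -expr2 ler_pM2l// sqr_norm_le_dot.
  rewrite normrM ler_pM//; first by have := le_coord_norm (z - x) i; rewrite !mxE.
  apply: le_trans rem; rewrite /r !mxE le_eqVlt; apply/orP; left; apply/eqP.
  congr (`| _ - _ |); apply: eq_bigr => k _; rewrite !mxE.
  by [].
- by apply/matrixP => i j; rewrite !mxE subrr !mul0r addr0.
- apply: filterE => z; apply/rowP => j.
  rewrite mulmxDr [RHS]mxE.
  have -> : ((z - x) *m E z) ord0 j = r z j.
    rewrite mxE; under eq_bigr do rewrite [E z _ _]mxE mulrA mulrA.
    rewrite -!mulr_suml -/(dot (z - x) (z - x)).
    have [d0|d0] := eqVneq (dot (z - x) (z - x)) 0; last by rewrite mulrAC divff// mul1r.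
    have zx : z = x by apply/eqP; rewrite -subr_eq0 dot0.
    by rewrite d0 !mul0r /r zx !subrr mul0mx subrr mxE.
  by rewrite /r [X in _ = _ + X]mxE [X in _ + (_ + X)]mxE addrC subrK.
Qed.

End smooth_functions.

(** * Legendre transform and the Monge-Ampere functional *)

Section legendre_transform.
Context (R : realType) (d : nat).
Implicit Types (a b Psi : 'rV[R]_d -> R) (x y : 'rV[R]_d).
Local Notation mu := (lebesgue_rV R d).

Lemma dotBr (x y z : 'rV[R]_d) : dot x (y - z) = dot x y - dot x z.
Proof. by rewrite /dot -sumrB; apply: eq_bigr => i _; rewrite !mxE mulrBr. Qed.

Lemma dotC x y : dot x y = dot y x.
Proof. by apply: eq_bigr => i _; rewrite mulrC. Qed.

Lemma dot0l y : dot 0 y = 0.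
Proof. by rewrite /dot big1// => i _; rewrite mxE mul0r. Qed.

Lemma legendre_ge Psi x y : ((dot x y - Psi x)%:E <= legendre Psi y)%E.
Proof. by apply: ereal_sup_ubound; exists x. Qed.

Lemma continuous_dotr x : continuous (fun y => dot x y).
Proof.
move=> y; apply: (cvg_big _ (nbhs_filter y)) => [|i _]; first exact: add_continuous.
apply: (cvgM (FF := nbhs_filter y)); first exact: cvg_cst.
exact: coord_continuous.
Qed.

(** As a supremum of continuous functions, the Legendre transform is lower
    semicontinuous: its strict superlevel sets are unions of open half-spaces. *)
Lemma measurable_legendre Psi : measurable_fun setT (legendre Psi).
Proof.
apply: (measurability _ (ErealGenOInfty.measurableE R)).
move=> /= _ [_ [c ->]] <-; rewrite setTI; apply: open_measurable_rV.
have -> : legendre Psi @^-1` `]c%:E, +oo[ =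
    \bigcup_x [set y | c + Psi x < dot x y].
  apply/seteqP; split=> y /=.
    rewrite in_itv/= andbT => /ereal_sup_gt[_ [x _ <-]].
    by rewrite lte_fin ltrBrDr => cx; exists x.
  move=> [x _ /= cx]; rewrite in_itv/= andbT; apply: lt_le_trans (legendre_ge Psi x y).
  by rewrite lte_fin ltrBrDr.
apply: bigcup_open => x _.
have /continuousP/(_ [set r | c + Psi x < r]) := @continuous_dotr x.
by apply; exact: open_gt.
Qed.

Definition conjugate Psi y := fine (legendre Psi y).

Lemma measurable_conjugate Psi : measurable_fun setT (conjugate Psi).
Proof. exact: measurableT_comp (fine_measurable _) (measurable_legendre Psi). Qed.

Definition proper_legendre Psi := forall y, legendre Psi y \is a fin_num.

Lemma fenchel Psi x y : proper_legendre Psi -> dot x y <= Psi x + conjugate Psi y.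
Proof.
move=> fin; have := legendre_ge Psi x y.
by rewrite -(fineK (fin y)) lee_fin /conjugate; lra.
Qed.

Lemma conjugate_le Psi y c : proper_legendre Psi ->
  (forall x, dot x y - Psi x <= c) -> conjugate Psi y <= c.
Proof.
move=> fin le_c; rewrite -lee_fin fineK//; apply: ge_ereal_sup => _ [x _ <-].
by rewrite lee_fin.
Qed.

Lemma J_conjugate a b Psi : proper_legendre Psi ->
  J a b Psi = (\int[mu]_x (Psi x * a x)%:E + \int[mu]_y (conjugate Psi y * b y)%:E)%E.
Proof.
move=> fin; congr (_ + _)%E; apply: eq_integral => y _.
by rewrite EFinM fineK.
Qed.

Section weights.
Variables (a b : 'rV[R]_d -> R).
Hypotheses (a_gt0 : forall x, 0 < a x) (b_gt0 : forall x, 0 < b x).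
Hypothesis a_int : mu.-integrable setT (EFin \o a).
Hypothesis b_int : mu.-integrable setT (EFin \o b).

Lemma minorized_primal Psi : proper_legendre Psi -> measurable_fun setT Psi ->
  minorized mu (fun x => Psi x * a x).
Proof.
move=> fin mPsi; apply: (@minorizedM _ _ _ _ (- conjugate Psi 0)) => //.
  by move=> x; have := fenchel x 0 fin; rewrite dotC dot0l; lra.
by move=> x; exact: ltW.
Qed.

Lemma minorized_dual Psi : proper_legendre Psi ->
  minorized mu (fun y => conjugate Psi y * b y).
Proof.
move=> fin; apply: (@minorizedM _ _ _ _ (- Psi 0)) => //.
- exact: measurable_conjugate.
- by move=> y; have := fenchel 0 y fin; rewrite dot0l; lra.
- by move=> x; exact: ltW.
Qed.

(** For each [y] the Legendre transform is convex in the function, being a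
    supremum of affine expressions in it. A convex combination [P] may leave the
    family, but its Legendre transform stays finite and measurable. *)
Lemma J_convex : convex_functional (@smooth_legendre_family R d) (J a b).
Proof.
move=> t P0 P1 /andP[t0 t1] [sP0 _ fin0 _] [sP1 _ fin1 _].
have mP0 := continuous_measurable_rV (smooth_continuous sP0).
have mP1 := continuous_measurable_rV (smooth_continuous sP1).
have t10 : 0 <= 1 - t by rewrite subr_ge0.
set P := fun x => _.
have leP y : (legendre P y <=
    ((1 - t) * conjugate P0 y + t * conjugate P1 y)%:E)%E.
  apply: ge_ereal_sup => _ [x _ <-]; rewrite lee_fin /P.
  have : (1 - t) * (dot x y - P0 x) <= (1 - t) * conjugate P0 y.
    by rewrite ler_wpM2l//; have := fenchel x y fin0; lra.
  have : t * (dot x y - P1 x) <= t * conjugate P1 y.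
    by rewrite ler_wpM2l//; have := fenchel x y fin1; lra.
  lra.
have fin : proper_legendre P.
  move=> y; rewrite fin_numElt (lt_le_trans _ (legendre_ge P 0 y)) ?ltNyr//=.
  by rewrite (le_lt_trans (leP y)) ?ltry.
have mP : measurable_fun setT P.
  by apply: measurable_funD; exact: measurable_funM.
have JE s Q : 0 <= s -> proper_legendre Q -> measurable_fun setT Q ->
    (s%:E * J a b Q = \int[mu]_x (s * (Q x * a x))%:E +
      \int[mu]_y (s * (conjugate Q y * b y))%:E)%E.
  move=> s0 finQ mQ.
  have mp := minorized_primal finQ mQ; have md := minorized_dual finQ.
  rewrite J_conjugate// !integral_minorizedZ//; apply: muleDr => //.
  by rewrite ltninfty_adde_def// inE integral_minorized_gtNy.
have m0 := minorizedZ t10 (minorized_primal fin0 mP0).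
have m1 := minorizedZ t0 (minorized_primal fin1 mP1).
have n0 := minorizedZ t10 (minorized_dual fin0).
have n1 := minorizedZ t0 (minorized_dual fin1).
rewrite (JE _ _ t10 fin0 mP0) (JE _ _ t0 fin1 mP1) J_conjugate//.
apply: le_trans (_ : _ <= (\int[mu]_x ((1 - t) * (P0 x * a x) + t * (P1 x * a x))%:E +
  \int[mu]_y ((1 - t) * (conjugate P0 y * b y) + t * (conjugate P1 y * b y))%:E)%E)%E _;
  last by rewrite (integral_minorizedD m0 m1) (integral_minorizedD n0 n1) addeACA.
apply: leeD.
  by under eq_integral do rewrite mulrDl -!mulrA.
apply: le_integral_minorized; first exact: minorized_dual.
  by apply: measurable_funD; [exact: n0.1|exact: n1.1].
move=> y; rewrite !mulrA -mulrDl; apply: ler_wpM2r; first exact: ltW.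
by rewrite -lee_fin fineK.
Qed.

Hypothesis same_mass : (\int[mu]_x (a x)%:E = \int[mu]_y (b y)%:E)%E.

Lemma smooth_convex_gradient Phi : smooth_legendre_family Phi ->
  (forall x, symmetric_positive (hessian Phi x)) ->
  convex_gradient Phi (gradient Phi) (hessian Phi).
Proof.
move=> [sPhi cPhi fin _] pos; split.
- by move=> x z; apply: convex_subgradient => //; exact: (sPhi [::] x).
- by move=> y; exists (conjugate Phi y) => x; have := fenchel x y fin; lra.
- by move=> x; exact: smooth_caratheodory.
- move=> i j x; under eq_fun do rewrite mxE.
  exact/differentiable_continuous/(sPhi [:: i; j] x).
- by move=> x; exact: (pos x).2.
Qed.

(** The change of variables [y = gradient Phi x] moves the second integral of
    [J] onto [a]. It is available for nonnegative integrands, whence the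
    shift of the conjugate by the constant [c = Psi 0]; the two integrals of the
    shift itself agree because [a] and [b] have the same mass. *)
Lemma J_transport Phi Psi : smooth_legendre_family Phi ->
  monge_ampere_solution a b Phi -> proper_legendre Psi -> measurable_fun setT Psi ->
  minorized mu (fun x => (Psi x + conjugate Psi (gradient Phi x)) * a x) /\
  (J a b Psi = \int[mu]_x ((Psi x + conjugate Psi (gradient Phi x)) * a x)%:E)%E.
Proof.
move=> FPhi [_ pos MA] fin mPsi.
have cg := smooth_convex_gradient FPhi pos.
have mT : measurable_fun setT (gradient Phi).
  by apply: continuous_measurable_fun_rV => i; exact: convex_gradient_continuous cg _.
have mcT : measurable_fun setT (fun x => conjugate Psi (gradient Phi x)).
  exact: measurableT_comp (measurable_conjugate Psi) mT.
have a0 x : 0 <= a x by exact: ltW.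
have b0 x : 0 <= b x by exact: ltW.
have mb : measurable_fun setT b by apply/measurable_EFinP; exact: measurable_int b_int.
pose c := Psi 0.
have ge_c y : 0 <= conjugate Psi y + c.
  by have := fenchel 0 y fin; rewrite dot0l addrC.
have mT1 : minorized mu (fun x => conjugate Psi (gradient Phi x) * a x).
  by apply: (@minorizedM _ _ _ _ (- c)) => // x; have := ge_c (gradient Phi x); lra.
have mc1 (w : 'rV[R]_d -> R) : mu.-integrable setT (EFin \o w) ->
    (forall x, 0 <= w x) -> minorized mu (fun x => - c * w x).
  by move=> iw w0; apply: (@minorizedM _ _ _ _ (- c)).
have shift (h w : 'rV[R]_d -> R) : measurable_fun setT h -> (forall x, 0 <= h x + c) ->
    mu.-integrable setT (EFin \o w) -> (forall x, 0 <= w x) ->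
    (\int[mu]_x (h x * w x)%:E =
     (- c)%:E * \int[mu]_x (w x)%:E + \int[mu]_x ((h x + c) * w x)%:E)%E.
  move=> mh h0 iw w0.
  rewrite -(integralZl measurableT iw).
  transitivity (\int[mu]_x (- c * w x + (h x + c) * w x)%:E)%E.
    by apply: eq_integral => x _; congr (_%:E); lra.
  apply: integral_minorizedD; first exact: mc1.
  apply: (@minorizedM _ _ _ _ 0) => //; first exact: measurable_funD.
have E : (\int[mu]_y (conjugate Psi y * b y)%:E =
    \int[mu]_x (conjugate Psi (gradient Phi x) * a x)%:E)%E.
  rewrite (shift _ _ (measurable_conjugate Psi) ge_c b_int b0).
  rewrite (shift _ _ mcT (fun x => ge_c _) a_int a0) same_mass; congr (_ + _)%E.
  rewrite -(ge0_integral_convex_gradient cg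
    (f := fun y => ((conjugate Psi y + c) * b y)%:E)).
  - apply: eq_integral => x _; rewrite -EFinM -mulrA; congr (_ * _)%:E.
    exact: MA.
  - apply/measurable_EFinP; apply: measurable_funM => //.
    by apply: measurable_funD => //; exact: measurable_conjugate.
  - by move=> y; rewrite lee_fin mulr_ge0.
have mPa := minorized_primal fin mPsi.
have DE : (fun x => (Psi x + conjugate Psi (gradient Phi x)) * a x) =
    (fun x => Psi x * a x + conjugate Psi (gradient Phi x) * a x).
  by apply/funext => x; rewrite mulrDl.
split; first by rewrite DE; exact: minorizedD.
rewrite J_conjugate// E -integral_minorizedD//.
by apply: eq_integral => x _; rewrite mulrDl.
Qed.

(** Fenchel's inequality at the points [(x, gradient Phi x)], which is an equality
    for [Psi = Phi] because [gradient Phi x] is a subgradient of [Phi] at [x]. *)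
Lemma monge_ampere_minimizer Phi : smooth_legendre_family Phi ->
  monge_ampere_solution a b Phi ->
  minimizer (@smooth_legendre_family R d) (J a b) Phi.
Proof.
move=> FPhi sol; split=> // Psi [sPsi _ fin _].
have [_ pos _] := sol; have cg := smooth_convex_gradient FPhi pos.
have [sPhi _ finPhi _] := FPhi.
have mPsi := continuous_measurable_rV (smooth_continuous sPsi).
have mPhi := continuous_measurable_rV (smooth_continuous sPhi).
have [mnPhi ->] := J_transport FPhi sol finPhi mPhi.
have [[mPsiT _] ->] := J_transport FPhi sol fin mPsi.
apply: le_integral_minorized => // x; apply: ler_wpM2r; first exact: ltW.
apply: le_trans (fenchel x (gradient Phi x) fin).
suff : conjugate Phi (gradient Phi x) <= dot x (gradient Phi x) - Phi x by lra.
apply: conjugate_le => // z; have := subgradient cg x z.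
by rewrite dotBr (dotC _ z) (dotC _ x); lra.
Qed.

End weights.
End legendre_transform.

Theorem proposition2p1 (R : realType) (d : nat) (alpha beta : 'rV[R]_d -> R)
  (alpha_gt0 : forall x, 0 < alpha x)
  (beta_gt0 : forall y, 0 < beta y)
  (alpha_int : (lebesgue_rV R d).-integrable setT (EFin \o alpha))
  (beta_int : (lebesgue_rV R d).-integrable setT (EFin \o beta))
  (same_integral :
    (\int[lebesgue_rV R d]_x (alpha x)%:E =
     \int[lebesgue_rV R d]_y (beta y)%:E)%E) :
  convex_functional (@smooth_legendre_family R d) (J alpha beta) /\
  forall Phi : 'rV[R]_d -> R,
    @smooth_legendre_family R d Phi ->
    monge_ampere_solution alpha beta Phi ->
    minimizer (@smooth_legendre_family R d) (J alpha beta) Phi.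
Proof.
split; first exact: J_convex.
by move=> Phi; exact: monge_ampere_minimizer.
Qed.
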